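(* Let $d\ge 1$, let $P_k:\mathbb{C}^d\to\mathbb{C}$ be a non-zero homogeneous polynomial of degree $k\ge 2$ with complex coefficients, and let $\rho$ be a natural number with $1\le\rho<k$. (i) If the polynomials in $\{\partial^{\alpha}P_k : |\alpha|=\rho\}$ do not have a common zero $c\in\mathbb{C}^d\setminus\{0\}$, then, setting $$C_1 := k^{-\rho}\binom{d+\rho-1}{\rho}^{-1/2}\min_{\eta\in\mathbb{S}^{2d-1}}\Big(\sum_{|\alpha|=\rho}|\partial^{\alpha}P_k(\eta)|^2\Big)^{1/2},$$ we have, for all $m\ge 0$ and all $f_m\in\mathcal{P}_m(\mathbb{C}^d)$, $$\|P_k\cdot f_m\|_a\ \ge\ C_1\,(m+d)^{(k-\rho)/2}\,\|f_m\|_a .$$ (ii) If there is a $c\in\mathbb{C}^d$ with $|c|=1$ and $(\partial^{\alpha}P_k)(c)=0$ for all multi-indices $\alpha$ with $|\alpha|=\rho$, then, setting $$C_2 := \Big(\sum_{\rho<|\alpha|\le k}\frac{|(\partial^{\alpha}P_k^{*})(\overline{c})|^2}{\alpha!}\Big)^{1/2},$$ we have, for all $m\ge k$, $$\|P_k(z)\,\langle z,c\rangle_2^{m}\|_a\ \le\ C_2\, m^{(k-\rho-1)/2}\,\|\langle z,c\rangle_2^{m}\|_a .$$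
   Context: $\mathcal{P}(\mathbb{C}^d)=\mathbb{C}[z_1,\dots,z_d]$, and $\mathcal{P}_m(\mathbb{C}^d)$ is its subspace of homogeneous polynomials of degree $m$ (including $0$). Multi-indices $\alpha\in\mathbb{N}^d$ (with $0\in\mathbb{N}$) use the standard notations $\alpha!=\alpha_1!\cdots\alpha_d!$, $|\alpha|=\alpha_1+\cdots+\alpha_d$, $z^\alpha=z_1^{\alpha_1}\cdots z_d^{\alpha_d}$; $\partial^\alpha$ is the corresponding partial derivative in $z_1,\dots,z_d$. For a polynomial $P$, $P^{*}$ is the polynomial obtained by conjugating its coefficients. $\langle z,w\rangle_2=\sum_{j=1}^d z_j\overline{w_j}$ is the canonical Hermitian inner product on $\mathbb{C}^d$, $|z|$ the associated norm, $\overline{c}$ is the coordinatewise conjugate of $c$, and $\mathbb{S}^{2d-1}=\{z\in\mathbb{C}^d:|z|=1\}$. The apolar inner product of $P=\sum_\alpha c_\alpha z^\alpha$ and $Q=\sum_\alpha d_\alpha z^\alpha$ is $\langle P,Q\rangle_a=\sum_{\alpha\in\mathbb{N}^d}\alpha!\,c_\alpha\overline{d_\alpha}$, and $\|f\|_a=\sqrt{\langle f,f\rangle_a}$. For fixed $c$, $\langle z,c\rangle_2^m$ is regarded as a polynomial in $z$. *)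

(* Defs.v *)
From HB Require Import structures.
From mathcomp Require Export all_boot all_order all_algebra.
From mathcomp Require Export complex mpoly.
From mathcomp Require Export classical_sets reals exp.
From mathcomp Require boolp topology normedtype derive realfun.
Export Order.TTheory GRing.Theory Num.Theory.
Export ComplexField.

Set Implicit Arguments.
Unset Strict Implicit.
Unset Printing Implicit Defensive.

Local Open Scope ring_scope.
Local Open Scope complex_scope.
Local Open Scope classical_set_scope.

Definition herm (R : realType) d (z w : 'rV[R[i]]_d) : R[i] :=
  \sum_j z 0 j * conjc (w 0 j).

Definition hnorm (R : realType) d (z : 'rV[R[i]]_d) : R :=
  Num.sqrt (complex.Re (herm z z)).

Definition csphere (R : realType) d : set 'rV[R[i]]_d :=
  [set z | hnorm z = 1].
Arguments csphere R d : clear implicits.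

Definition conjv (R : realType) d (c : 'rV[R[i]]_d) : 'rV[R[i]]_d :=
  \row_j conjc (c 0 j).

Definition mfact d (a : 'X_{1..d}) : nat := (\prod_(i < d) (a i)`!)%N.

Definition mconj (R : realType) d (P : {mpoly R[i][d]}) : {mpoly R[i][d]} :=
  map_mpoly conjc P.

(* The coefficients of P vanish off msupp P, so summing over this finite set is
   summing over all multi-indices. *)
Definition apolar (R : realType) d (P Q : {mpoly R[i][d]}) : R[i] :=
  \sum_(a <- msupp P) (mfact a)%:R * P@_a * conjc (Q@_a).

Definition apolar_norm (R : realType) d (P : {mpoly R[i][d]}) : R :=
  Num.sqrt (complex.Re (apolar P P)).

(* The polynomial z |-> herm z c *)
Definition herm_poly (R : realType) d (c : 'rV[R[i]]_d) : {mpoly R[i][d]} :=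
  \sum_j conjc (c 0 j) *: 'X_j.

(* 'X_{1..d < b} is the finite type of multi-indices a with mdeg a < b. *)
Definition deriv_norm (R : realType) d rho (P : {mpoly R[i][d]})
    (z : 'rV[R[i]]_d) : R :=
  Num.sqrt (\sum_(a : 'X_{1..d < rho.+1} | mdeg a == rho)
              Normc.normc (P^`M[a]).@[z 0] ^+ 2).

(* For 0 < d this infimum is a minimum: see [sphere_min_attained]. *)
Definition sphere_min (R : realType) d (F : 'rV[R[i]]_d -> R) : R :=
  inf [set F z | z in csphere R d].

Definition C1 (R : realType) d k rho (P : {mpoly R[i][d]}) : R :=
  k%:R ^- rho * 'C(d + rho - 1, rho)%:R `^ (- 2^-1)
    * sphere_min (deriv_norm rho P).

Definition C2 (R : realType) d k rho (P : {mpoly R[i][d]})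
    (c : 'rV[R[i]]_d) : R :=
  Num.sqrt (\sum_(a : 'X_{1..d < k.+1} | (rho < mdeg a <= k)%N)
              Normc.normc ((mconj P)^`M[a]).@[conjv c 0] ^+ 2 / (mfact a)%:R).

Section Attained.
Import topology normedtype derive realfun numFieldNormedType.Exports.
Local Open Scope classical_set_scope.
Local Open Scope ring_scope.
Variables (R : realType) (d : nat).

(* R[i]^d as R^(2d) *)
Let cplx (x : 'rV[R]_(d + d)) : 'rV[R[i]]_d :=
  \row_j Complex (x 0 (lshift d j)) (x 0 (rshift d j)).

Let cplx_surj (z : 'rV[R[i]]_d) : exists x, cplx x = z.
Proof.
exists (row_mx (\row_j complex.Re (z 0 j)) (\row_j complex.Im (z 0 j))).
apply/rowP => j; rewrite mxE row_mxEl row_mxEr !mxE.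
by case: (z 0 j).
Qed.

Let hnorm_cplx x : hnorm (cplx x) = Num.sqrt (\sum_j x 0 j ^+ 2).
Proof.
congr Num.sqrt; rewrite big_split_ord /= /herm raddf_sum -big_split /=.
by apply: eq_bigr => j _; rewrite !mxE /= mulrN opprK -!expr2.
Qed.

Let hnorm_eq1 x : (hnorm (cplx x) = 1) <-> (\sum_j x 0 j ^+ 2 = 1).
Proof.
have s0 : 0 <= \sum_j x 0 j ^+ 2 by apply: sumr_ge0 => j _; exact: sqr_ge0.
rewrite hnorm_cplx; split=> [h|->]; last exact: sqrtr1.
by rewrite -(sqr_sqrtr s0) h expr1n.
Qed.

Let contD (f g : 'rV[R]_(d + d) -> R) :
  continuous f -> continuous g -> continuous (fun x => f x + g x).
Proof. by move=> cf cg x; exact: (continuousD (cf x) (cg x)). Qed.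

Let contN (f : 'rV[R]_(d + d) -> R) :
  continuous f -> continuous (fun x => - f x).
Proof. by move=> cf x; exact: (continuousN (cf x)). Qed.

Let contM (f g : 'rV[R]_(d + d) -> R) :
  continuous f -> continuous g -> continuous (fun x => f x * g x).
Proof. by move=> cf cg x; exact: (continuousM (cf x) (cg x)). Qed.

Let cont_sum (I : Type) (r : seq I) (Q : pred I) (f : I -> 'rV[R]_(d + d) -> R) :
  (forall i, continuous (f i)) ->
  continuous (fun x => \sum_(i <- r | Q i) f i x).
Proof.
move=> h; elim: r => [|i r IH].
  by under boolp.eq_fun do rewrite big_nil; exact: cst_continuous.
under boolp.eq_fun do rewrite big_cons; case: (Q i) => //.
exact: contD.
Qed.

Let cont_sqr (f : 'rV[R]_(d + d) -> R) :
  continuous f -> continuous (fun x => f x ^+ 2).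
Proof. by move=> h; under boolp.eq_fun do rewrite expr2; exact: contM. Qed.

Let ccont (g : 'rV[R]_(d + d) -> R[i]) :=
  continuous (fun x => complex.Re (g x)) /\
  continuous (fun x => complex.Im (g x)).

Let ccontD g h : ccont g -> ccont h -> ccont (fun x => g x + h x).
Proof.
move=> [g1 g2] [h1 h2]; split.
- have -> : (fun x => complex.Re (g x + h x))
      = (fun x => complex.Re (g x) + complex.Re (h x)).
    by apply/boolp.funext => y /=; case: (g y); case: (h y).
  exact: contD.
- have -> : (fun x => complex.Im (g x + h x))
      = (fun x => complex.Im (g x) + complex.Im (h x)).
    by apply/boolp.funext => y /=; case: (g y); case: (h y).
  exact: contD.
Qed.

Let ccontM g h : ccont g -> ccont h -> ccont (fun x => g x * h x).
Proof.
move=> [g1 g2] [h1 h2]; split.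
- have -> : (fun x => complex.Re (g x * h x))
      = (fun x => complex.Re (g x) * complex.Re (h x)
                  - complex.Im (g x) * complex.Im (h x)).
    by apply/boolp.funext => y /=; case: (g y); case: (h y).
  by apply: contD; [exact: contM|apply: contN; exact: contM].
- have -> : (fun x => complex.Im (g x * h x))
      = (fun x => complex.Re (g x) * complex.Im (h x)
                  + complex.Im (g x) * complex.Re (h x)).
    by apply/boolp.funext => y /=; case: (g y); case: (h y).
  by apply: contD; exact: contM.
Qed.

Let ccont_cst c : ccont (fun=> c).
Proof. by split; exact: cst_continuous. Qed.

Let ccont_meval (Q : {mpoly R[i][d]}) : ccont (fun x => Q.@[cplx x 0]).
Proof.
elim/mpolyind: Q => [|c a Q _ _ IH].
  by under boolp.eq_fun do rewrite meval0; exact: ccont_cst.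
under boolp.eq_fun do rewrite mevalD mevalZ mevalX.
apply: ccontD => //; apply: ccontM; first exact: ccont_cst.
elim: (index_enum _) => [|j r IHr].
  by under boolp.eq_fun do rewrite big_nil; exact: ccont_cst.
under boolp.eq_fun do rewrite big_cons; apply: ccontM => //.
elim: (a j) => [|n IHn].
  by under boolp.eq_fun do rewrite expr0; exact: ccont_cst.
under boolp.eq_fun do rewrite exprS; apply: ccontM => //.
under boolp.eq_fun do rewrite mxE.
by split=> x; exact: coord_continuous.
Qed.

Lemma sphere_min_attained rho (P : {mpoly R[i][d]}) : (0 < d)%N ->
  exists2 z, csphere R d z & deriv_norm rho P z = sphere_min (deriv_norm rho P).
Proof.
move=> d0; pose K := [set x : 'rV[R]_(d + d) | \sum_j x 0 j ^+ 2 = 1].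
have cK : compact K.
  apply: bounded_closed_compact.
    exists 1; split => // M M1 x Kx.
    rewrite /= [leLHS]/Num.norm /= mx_normrE.
    apply: bigmax_le => [|[i j] _] /=; first exact: le_trans (ltW M1).
    rewrite ord1 (le_trans _ (ltW M1)) // -[leRHS]sqrtr1 -sqrtr_sqr ler_wsqrtr //.
    rewrite -Kx (bigD1 j) //= lerDl.
    by apply: sumr_ge0 => l _; exact: sqr_ge0.
  rewrite (_ : K = (fun x : 'rV[R]_(d + d) => \sum_j x 0 j ^+ 2) @^-1`
                     [set y | y = 1]) //.
  apply: preimage_closed; last exact: closed_eq.
  move=> x _; apply: cont_sum => j; apply: cont_sqr.
  exact: coord_continuous.
have K0 : K !=set0.
  exists (delta_mx 0 (lshift d (Ordinal d0))); rewrite /K /=.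
  rewrite (bigD1 (lshift d (Ordinal d0))) //= mxE !eqxx expr1n big1 ?addr0 //.
  by move=> j /negbTE jn; rewrite mxE jn andbF expr0n.
have cF : continuous (fun x => deriv_norm rho P (cplx x)).
  move=> x; apply: continuous_comp; last exact: sqrt_continuous.
  move: x; apply: cont_sum => a.
  have [c1 c2] := ccont_meval P^`M[a].
  rewrite (_ : (fun x => _) =
    (fun x => complex.Re (P^`M[a]).@[cplx x 0] ^+ 2
              + complex.Im (P^`M[a]).@[cplx x 0] ^+ 2)); last first.
    apply/boolp.funext => x; case: (P^`M[a].@[_]) => u v /=.
    by rewrite sqr_sqrtr // addr_ge0 ?sqr_ge0.
  by apply: contD; exact: cont_sqr.
have [x Kx xmin] := EVT_min_rV K0 cK (continuous_subspaceT cF).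
have Fx : [set deriv_norm rho P z | z in csphere R d]
            (deriv_norm rho P (cplx x)).
  by exists (cplx x) => //; apply/hnorm_eq1; move: Kx; rewrite inE.
have lbx : lbound [set deriv_norm rho P z | z in csphere R d]
            (deriv_norm rho P (cplx x)).
  move=> _ [z + <-]; have [y <-] := cplx_surj z => /hnorm_eq1 Ky.
  by apply: xmin; rewrite inE.
exists (cplx x); first by apply/hnorm_eq1; move: Kx; rewrite inE.
apply/eqP; rewrite eq_le; apply/andP; split.
  by apply: lb_le_inf => //; exists (deriv_norm rho P (cplx x)).
by apply: ge_inf => //; exists (deriv_norm rho P (cplx x)).
Qed.

End Attained.

(* Main.v *)
(* The apolar norm is the L^2 norm for the Gaussian measure
   [exp (- |z|^2) dz / pi^d], so an inequality between sums of [|f|^2] that holds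
   pointwise, possibly after integrating out some of the variables, passes to
   the apolar norms.  No integral is needed: the Gaussian expectation of
   [z^a * conj z^b] is [a! * (a == b)], and positivity of that functional is
   proved one variable at a time, by averaging over roots of unity and then
   applying the positivity of [p |-> sum_j j! p_j] on polynomials that are
   nonnegative on [0, +oo[.

   (i) In one variable [|g| <= |(z - w) g|], because the difference of the squares
   is [|(d/dz - conj w) g|^2].  Splitting [p] into linear factors gives
   [|p' g| <= deg p * |p g|], hence [|d_i P * f| <= k |P f|] in several variables
   by slicing, hence [|d^a P * f| <= k^rho |P f|] for [|a| = rho].  On the other
   hand the sum of the [|d^a P|^2] is at least [min^2 * |z|^(2 (k - rho))], and
   multiplying by [|z|^2] multiplies the squared norm of a homogeneous [f] of
   degree [m] by [m + d].

   (ii) With [l = <z, c>] and its adjoint [D], the derivative along [c], Leibniz'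
   rule for [D^m (l^m P)] gives
   [|l^m P|^2 = sum_j 'C(m, j) * m!/j! * |D^j P|^2], and [|D^j P|^2] is
   [j!^2 * sum_(|a| = k - j) |d^a P c|^2 / a!] by Euler's identity. The terms with
   [|a| <= rho] vanish, again by Euler's identity. *)

From HB Require Import structures.
Require Import Defs.
From mathcomp Require Import polyrcf separable cyclic cyclotomic.
From mathcomp Require Import ssrcomplements ring lra.

Set Implicit Arguments.
Unset Strict Implicit.
Unset Printing Implicit Defensive.

Local Open Scope ring_scope.

(* The sum is the integral of [p t * exp (- t)] over [t >= 0]. It equals [q.[0]]
   for [q] the sum of all the derivatives of [p], which solves [q - q^`() = p]:
   starting from a negative value, [q] would decrease up to its first root. *)
Lemma factorial_moment_ge0 (R : rcfType) (p : {poly R}) :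
  (forall t, 0 <= t -> 0 <= p.[t]) ->
  0 <= \sum_(i < size p) p`_i * i`!%:R.
Proof.
move=> p_ge0; pose q := \sum_(j < size p) p^`(j).
have q0E : q.[0] = \sum_(i < size p) p`_i * i`!%:R.
  rewrite horner_sum; apply: eq_bigr => i _.
  by rewrite horner_coef0 coef_derivn addn0 ffactnn mulr_natr.
have qE : q - q^`() = p.
  rewrite /q raddf_sum -sumrB.
  under eq_bigr do rewrite /= -derivnS -opprB.
  rewrite sumrN -(big_mkord xpredT (fun j => p^`(j.+1) - p^`(j))).
  by rewrite telescope_sumr // derivn_poly0 // sub0r opprK.
rewrite -q0E leNgt; apply/negP => q0_lt0.
have q_neq0 : q != 0 by apply: contraTneq q0_lt0 => ->; rewrite horner0 ltxx.
have [x x_gt0 [qx_ge0]] : exists2 x, 0 < x & 0 <= q.[x] /\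
    forall y, 0 < y -> y < x -> q.[y] < 0.
  (* Differentiation lowers the degree, so [p] and [q] share their leading coefficient; a negative
     one would make [p] negative far out. *)
  have lead_p : lead_coef p = lead_coef q.
    by rewrite -qE lead_coefDl // size_polyN lt_size_deriv.
  have lead_gt0 : 0 < lead_coef q.
    rewrite lt_neqAle eq_sym lead_coef_eq0 q_neq0 /= leNgt; apply/negP => lead_lt0.
    have [|B /(_ (Num.max B 0))] := @poly_pinfty_gt_lc _ (- p).
      by rewrite lead_coefN lead_p oppr_gt0.
    rewrite le_max lexx => /(_ isT); rewrite leNgt => /negP; apply.
    rewrite hornerN lead_coefN lead_p (@le_lt_trans _ _ 0) ?oppr_gt0 //.
    by rewrite oppr_le0 p_ge0 // le_max lexx orbT.
  have [B BP] := poly_pinfty_gt_lc lead_gt0.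
  pose b := Num.max B 1.
  have b_gt0 : 0 < b by rewrite lt_max ltr01 orbT.
  have qb : 0 <= q.[b] by apply: le_trans (ltW lead_gt0) (BP _ _); rewrite le_max lexx.
  have [x [x_gt0 qx noroot_x]] : exists x, [/\ 0 < x, 0 <= q.[x] &
      {in `]0, x[, forall z, ~~ root q z}].
    (* When no root precedes [b], the point [b] itself serves as [x], since [q] is nonnegative
       there. *)
    have := next_rootP q 0 b; set x := next_root q 0 b => xP.
    case: xP => [q0|y _ qy0 yb noroot_y|c _ cE noroot_c].
    - by rewrite q0 eqxx in q_neq0.
    - by exists y; rewrite qy0 (itvP yb).
    - by exists b.
  exists x => //; split=> // y y_gt0 y_ltx; rewrite ltNge; apply/negP => qy.
  have [||z] := @poly_ivt _ q 0 y; rewrite ?(ltW y_gt0) ?mulr_le0_ge0 ?(ltW q0_lt0) //.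
  rewrite in_itv /= le_eqVlt => /andP[/orP[/eqP <-|z_gt0] zy].
    by rewrite rootE lt_eqF.
  by apply/negP/noroot_x; rewrite in_itv /= z_gt0 (le_lt_trans zy).
move=> q_lt0.
(* As [q.[0] < 0 <= q.[x]], the mean value theorem yields a point of positive slope in between,
   whereas the derivative [q - p] is at most 0 there. *)
have [y] := poly_mvt q x_gt0; rewrite in_itv /= => /andP[y_gt0 y_ltx].
have : q^`().[y] <= 0.
  have : q^`() = q - p by rewrite -qE opprB addrC subrK.
  move=> ->; rewrite hornerD hornerN subr_le0.
  exact: le_trans (ltW (q_lt0 _ y_gt0 y_ltx)) (p_ge0 _ (ltW y_gt0)).
nra.
Qed.

(** * Roots of unity and averages over circles *)

(** Since [n] is invertible, ['X^n - 1] is separable, and its [n] distinct roots include a primitive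
    one. *)
Lemma prim_root_exists (F : closedFieldType) n :
  n%:R != 0 :> F -> exists z : F, n.-primitive_root z.
Proof.
move=> nF; have n_gt0 : (0 < n)%N by rewrite lt0n; apply: contraNneq nF => ->.
have [r] := closed_field_poly_normal ('X^n - 1 : {poly F}).
rewrite (monicP (monicXnsubC _ n_gt0)) scale1r => rE.
have /hasP[z _ zP] : has n.-primitive_root r.
  apply: has_prim_root => //.
  - by apply/allP => z; rewrite -root_prod_XsubC -rE.
  - by rewrite -separable_prod_XsubC -rE separable_Xn_sub_1.
  - by rewrite -ltnS -(size_prod_XsubC r id) -rE size_XnsubC.
by exists z.
Qed.

Lemma sum_unity_root (F : fieldType) n (v : F) :
  v ^+ n = 1 -> \sum_(l < n) v ^+ l = (v == 1)%:R * n%:R.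
Proof.
move=> vn; have [->|v_neq1] := eqVneq v 1.
  by under eq_bigr do rewrite expr1n; rewrite sumr_const card_ord mul1r.
rewrite mul0r; apply: (mulfI (x := v - 1)); first by rewrite subr_eq0.
by rewrite mulr0 -subrX1 vn subrr.
Qed.

(* Integrating over circles only leaves the terms with [a i = b i], and the
   radial variable [|z|^2] is exponentially distributed. *)
Lemma gauss_moment_ge0 (R : rcfType) (I : eqType) (s : seq I) (g : I -> R[i])
    (a b : I -> nat) :
  (forall z, 0 <= complex.Re (\sum_(i <- s) g i * (z ^+ a i * conjc z ^+ b i))) ->
  0 <= complex.Re (\sum_(i <- s) g i * ((a i == b i)%:R * (a i)`!%:R)).
Proof.
(* [N] exceeds every exponent, so exponents congruent modulo [N] are equal and averaging over the
   [N]-th roots of unity isolates the terms with [a i = b i]. *)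
move=> Hge0; pose N := (\max_(i <- s) maxn (a i) (b i)).+1.
have [w wP] : exists w : R[i], N.-primitive_root w.
  by apply: prim_root_exists; rewrite pnatr_eq0.
have w1 : w * conjc w = 1.
  rewrite -sqr_normc; apply/eqP; rewrite pexpr_eq1 // -(@pexpr_eq1 _ _ N) //.
  by rewrite -normrX (prim_expr_order wP) normr1.
have w_neq0 : w != 0.
  by apply: contra_eq_neq w1 => ->; rewrite mul0r eq_sym oner_eq0.
have wJ l : conjc w ^+ l = w ^- l.
  by rewrite -exprVn; congr (_ ^+ _); rewrite -[RHS]mulr1 -w1 mulKf // w_neq0.
(* [p.[t]] is the average of the assumed nonnegative quantity over [N] points of the circle
   [|z|^2 = t]. *)
pose p := \sum_(i <- s) (a i == b i)%:R * complex.Re (g i) *: 'X^(a i).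
have ltN i : i \in s -> (a i < N)%N /\ (b i < N)%N.
  move=> si; have := @leq_bigmax_seq _ s xpredT (fun i => maxn (a i) (b i)) i si isT.
  by rewrite geq_max !ltnS => /andP.
have abE i : i \in s -> (w ^+ a i * conjc w ^+ b i == 1) = (a i == b i).
  move=> si; have [aN bN] := ltN i si.
  rewrite wJ -(inj_eq (mulIf (expf_neq0 (b i) w_neq0))) mul1r.
  by rewrite divfK ?expf_neq0 ?w_neq0 // (eq_prim_root_expr wP) !modn_small.
have p_ge0 t : 0 <= t -> 0 <= p.[t].
  move=> t_ge0.
  have [r rJ r2] : exists2 r : R[i], conjc r = r & r ^+ 2 = t%:C%C.
    exists (Num.sqrt t)%:C%C; first exact: conjc_real.
    by rewrite -rmorphXn /= sqr_sqrtr.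
  have : 0 <= complex.Re (\sum_(l < N) \sum_(i <- s)
           g i * ((r * w ^+ l) ^+ a i * conjc (r * w ^+ l) ^+ b i)).
    by rewrite raddf_sum; apply: sumr_ge0 => l _; exact: Hge0.
  rewrite exchange_big /=.
  have termE i : i \in s ->
      \sum_(l < N) g i * ((r * w ^+ l) ^+ a i * conjc (r * w ^+ l) ^+ b i)
      = g i * ((a i == b i)%:R * t ^+ a i * N%:R)%:C%C.
    move=> si; rewrite -mulr_sumr; congr (_ * _).
    transitivity (r ^+ a i * r ^+ b i * \sum_(l < N) (w ^+ a i * conjc w ^+ b i) ^+ l).
      rewrite mulr_sumr; apply: eq_bigr => l _.
      rewrite (rmorphM conjc) (rmorphXn conjc) /= rJ !exprMn -!exprM (mulnC l) (mulnC l).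
      rewrite !exprM; ring.
    rewrite sum_unity_root; last first.
      rewrite exprMn -!exprM (mulnC (a i)) (mulnC (b i)) !exprM (prim_expr_order wP).
      by rewrite expr1n mul1r wJ (prim_expr_order wP) invr1 expr1n.
    rewrite abE //; have [ab|ab] := eqVneq; last by rewrite !mul0r mulr0.
    rewrite !mul1r -ab -exprD addnn -mul2n exprM r2.
    by rewrite rmorphM rmorphXn /= rmorph_nat.
  rewrite (eq_big_seq _ termE) raddf_sum /=.
  have -> : p.[t] = N%:R^-1 * \sum_(i <- s)
      complex.Re (g i * ((a i == b i)%:R * t ^+ a i * N%:R)%:C%C).
    rewrite horner_sum mulr_sumr; apply: eq_bigr => i _.
    rewrite hornerZ hornerXn.
    case: (g i) => x y /=; rewrite mulr0 subr0.
    have : N%:R != 0 :> R by rewrite pnatr_eq0.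
    by move=> ?; field.
  by move=> ?; rewrite mulr_ge0 // invr_ge0 ler0n.
have size_p : (size p <= N)%N.
  rewrite (leq_trans (size_sum _ _ _)) //; apply/bigmax_leqP_seq => i si _.
  by rewrite (leq_trans (size_scale_leq _ _)) // size_polyXn; case: (ltN i si).
have := factorial_moment_ge0 p_ge0.
have -> : \sum_(j < size p) p`_j * j`!%:R = \sum_(j < N) p`_j * j`!%:R.
  rewrite (big_ord_widen _ (fun j => p`_j * j`!%:R) size_p) big_mkcond.
  apply: eq_bigr => j _; case: ltnP => // pj.
  by rewrite nth_default ?mul0r.
rewrite raddf_sum /=; under eq_bigr => j _ do rewrite coef_sum mulr_suml.
rewrite exchange_big /=.
rewrite (eq_big_seq (fun i => complex.Re (g i * ((a i == b i)%:R * (a i)`!%:R)))) //.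
move=> i si; have [aN _] := ltN i si.
rewrite (bigD1 (Ordinal aN)) //= big1 ?addr0; last first.
  by move=> j /negPf jn; rewrite coefZ coefXn -val_eqE /= in jn *; rewrite jn mulr0 mul0r.
rewrite coefZ coefXn eqxx mulr1 -natrM -(rmorph_nat (real_complex R)) natrM.
by case: (g i) => x y /=; rewrite mulr0 subr0; ring.
Qed.

(** * The Gaussian norm in one variable *)

Section GaussNorm.
Variable R : realType.
Implicit Types (p q g : {poly R[i]}) (w x y : R[i]).
Local Notation normc := Normc.normc.

Lemma normc_sqrE x : normc x ^+ 2 = complex.Re x ^+ 2 + complex.Im x ^+ 2.
Proof. by case: x => a b /=; rewrite sqr_sqrtr // addr_ge0 ?sqr_ge0. Qed.

Lemma normc_sqrJ x : normc x ^+ 2 = complex.Re (x * conjc x).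
Proof. by rewrite normc_sqrE; case: x => a b /=; rewrite mulrN opprK. Qed.

Lemma Re_mulCl (a : R) x : complex.Re (a%:C%C * x) = a * complex.Re x.
Proof. by case: x => b c /=; rewrite mul0r subr0. Qed.

(* The squared norm of [p] in L^2 of the complex Gaussian measure
   [exp (- |z|^2) dz / pi]. *)
Definition gauss_norm p : R := \sum_(i < size p) i`!%:R * normc p`_i ^+ 2.

Lemma gauss_normE n p : (size p <= n)%N ->
  gauss_norm p = \sum_(i < n) i`!%:R * normc p`_i ^+ 2.
Proof.
move=> pn; rewrite /gauss_norm (big_ord_widen _ (fun i => i`!%:R * normc p`_i ^+ 2) pn).
rewrite big_mkcond; apply: eq_bigr => i _; case: ltnP => // pi.
by rewrite nth_default // Normc.normc0 expr0n mulr0.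
Qed.

Lemma gauss_norm_ge0 p : 0 <= gauss_norm p.
Proof. by apply: sumr_ge0 => i _; rewrite mulr_ge0 ?ler0n ?sqr_ge0. Qed.

Lemma gauss_norm0 : gauss_norm 0 = 0.
Proof. by rewrite /gauss_norm size_poly0 big_ord0. Qed.

Lemma gauss_normZ w p : gauss_norm (w *: p) = normc w ^+ 2 * gauss_norm p.
Proof.
rewrite (gauss_normE (size_scale_leq w p)) mulr_sumr; apply: eq_bigr => i _.
by rewrite coefZ Normc.normcM exprMn mulrCA.
Qed.

(** Coefficientwise, the difference of the two sides is a multiple of [|n p_i - q_i|^2]. The weights
    are the optimal ones for summands whose norms are in ratio [1 : n], with denominators
    cleared. *)
Lemma gauss_normD_le n p q :
  n%:R * gauss_norm (p + q)
    <= n%:R * n.+1%:R * gauss_norm p + n.+1%:R * gauss_norm q.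
Proof.
rewrite (gauss_normE (size_polyD p q)) (gauss_normE (leq_maxl (size p) (size q))).
rewrite (gauss_normE (leq_maxr (size p) (size q))) !mulr_sumr -big_split /=.
apply: ler_sum => i _; rewrite coefD !normc_sqrE -subr_ge0.
case: (p`_i) (q`_i) => [a b] [c e] /=.
rewrite [X in 0 <= X](_ : _ =
  i`!%:R * ((n%:R * a - c) ^+ 2 + (n%:R * b - e) ^+ 2)); last by rewrite -natr1; ring.
by rewrite mulr_ge0 ?ler0n // addr_ge0 ?sqr_ge0.
Qed.

Lemma gauss_norm_mulXsubC w p : gauss_norm p <= gauss_norm (('X - w%:P) * p).
Proof.
have sz : (size (('X - w%:P) * p)%R <= (size p).+1)%N.
  by rewrite (leq_trans (size_polyMleq _ _)) // size_XsubC.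
rewrite (gauss_normE sz) /gauss_norm.
(* [b n] is the boundary term of the partial sums; it vanishes at [n = size p], where the comparison
   of partial sums becomes the claim. *)
pose b n := n`!%:R * (normc (w * p`_n) ^+ 2 - n%:R * normc p`_n ^+ 2).
(* The increments differ by [n`! * |(n + 1) p_(n + 1) - conjc w * p_n| ^ 2]. *)
suff le_sum n : \sum_(i < n) i`!%:R * normc p`_i ^+ 2 + b n
    <= \sum_(i < n.+1) i`!%:R * normc (('X - w%:P) * p)`_i ^+ 2.
  have := le_sum (size p).
  by rewrite /b nth_default // mulr0 Normc.normc0 expr0n mulr0 subr0 mulr0 addr0.
elim: n => [|n IH].
  rewrite big_ord0 big_ord1 /b mulrBl coefB coefXM coefCM /= !normc_sqrE /=.
  case: (w) (p`_0) => [a c] [e f] /=.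
  rewrite le_eqVlt; apply/orP; left; apply/eqP; ring.
rewrite big_ord_recr [leRHS]big_ord_recr /=.
suff : n`!%:R * normc p`_n ^+ 2 + b n.+1 - b n
    <= n.+1`!%:R * normc (('X - w%:P) * p)`_n.+1 ^+ 2 by lra.
rewrite /b mulrBl coefB coefXM coefCM /= factS natrM !normc_sqrE -subr_ge0.
case: (w) (p`_n) (p`_n.+1) => [a c] [e f] [k l] /=.
rewrite [X in 0 <= X](_ : _ =
  n`!%:R * ((n.+1%:R * k - (a * e + c * f)) ^+ 2
            + (n.+1%:R * l - (a * f - c * e)) ^+ 2)); last by rewrite -natr1; ring.
by rewrite mulr_ge0 ?ler0n // addr_ge0 ?sqr_ge0.
Qed.

(** Induction on the linear factors. In the product rule, one term only lacks the factor
    ['X - w%:P], and the other falls under the induction hypothesis with that factor absorbed into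
    [g]. The weights of [gauss_normD_le] turn [n^2] into [(n + 1)^2]. *)
Lemma gauss_norm_deriv_prod (s : seq R[i]) g :
  let p := \prod_(w <- s) ('X - w%:P) in
  gauss_norm (p^`() * g) <= (size s)%:R ^+ 2 * gauss_norm (p * g).
Proof.
elim: s g => [|w s IH] g /=.
  by rewrite big_nil -polyC1 derivC mul0r gauss_norm0 mulr_ge0 ?sqr_ge0 ?gauss_norm_ge0.
rewrite big_cons; set p := \prod_(_ <- s) _ in IH *.
have -> : (('X - w%:P) * p)^`() * g = p * g + p^`() * (('X - w%:P) * g).
  by rewrite derivM derivXsubC; ring.
have le1 : gauss_norm (p * g) <= gauss_norm (('X - w%:P) * p * g).
  by rewrite -mulrA; exact: gauss_norm_mulXsubC.
have le2 : gauss_norm (p^`() * (('X - w%:P) * g))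
    <= (size s)%:R ^+ 2 * gauss_norm (('X - w%:P) * p * g).
  by rewrite -mulrA [X in _ * gauss_norm X]mulrCA; exact: IH.
(* A single factor is treated apart: [gauss_normD_le] says nothing about the sum when its weight [n]
   is 0. *)
case: s => [|w' s] in p IH le1 le2 *.
  have -> : p^`() = 0 by rewrite /p big_nil -polyC1 derivC.
  by rewrite mul0r addr0 expr1n mul1r.
set n := size _ in le2 *.
have n_gt0 : 0 < n%:R :> R by rewrite ltr0n.
rewrite -(ler_pM2l n_gt0) (le_trans (gauss_normD_le _ _ _)) //.
rewrite /= -/n -natr1; move: le1 le2 n_gt0.
set A := gauss_norm _; set B := gauss_norm _; set C := gauss_norm _.
set t := n%:R => le1 le2 t_gt0.
have -> : t * ((t + 1) ^+ 2 * B) = t * (t + 1) * B + (t + 1) * (t ^+ 2 * B) by ring.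
by rewrite lerD // ler_pM2l ?mulr_gt0 ?addr_gt0.
Qed.

(** Splitting over the complex numbers reduces to the monic case. Only a degree bound is assumed
    because slices of a homogeneous polynomial may drop in degree. *)
Lemma gauss_norm_deriv n p g : (size p <= n.+1)%N ->
  gauss_norm (p^`() * g) <= n%:R ^+ 2 * gauss_norm (p * g).
Proof.
have [s pE] := closed_field_poly_normal p; have [->|p_neq0] := eqVneq p 0.
  by rewrite linear0 !mul0r gauss_norm0 mulr0.
move=> pn; have sn : (size s <= n)%N.
  move: pn; rewrite pE size_scale ?lead_coef_eq0 //.
  by rewrite size_prod_XsubC.
rewrite pE derivZ -!scalerAl !gauss_normZ mulrCA ler_wpM2l ?sqr_ge0 //.
rewrite (le_trans (gauss_norm_deriv_prod _ _)) // ler_wpM2r ?gauss_norm_ge0 //.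
by rewrite lerXn2r ?nnegrE ?ler0n // ler_nat.
Qed.

End GaussNorm.

(** * The apolar inner product *)

Section Apolar.
Variables (R : realType) (d : nat).
Implicit Types (P Q f g : {mpoly R[i][d]}) (m : 'X_{1..d}).
Local Notation normc := Normc.normc.

Lemma mfactS m i : mfact (m + U_(i)) = ((m i).+1 * mfact m)%N.
Proof.
rewrite /mfact (bigD1 i) //= [in RHS](bigD1 i) //= mulnA.
rewrite mnmDE mnm1E eqxx addn1 factS; congr (_ * _)%N.
by apply: eq_bigr => j /negPf ji; rewrite mnmDE mnm1E eq_sym ji addn0.
Qed.

Lemma mfact_gt0 m : (0 < mfact m)%N.
Proof. by apply: prodn_gt0 => i; exact: fact_gt0. Qed.

Lemma mnm_ind (T : 'X_{1..d} -> Prop) :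
  T 0%MM -> (forall i m, T m -> T (U_(i) + m)%MM) -> forall m, T m.
Proof.
move=> T0 TS m; move: {2}(mdeg m) (erefl (mdeg m)) => n.
elim: n m => [|n IH] m mn; first by move/eqP: mn; rewrite mdeg_eq0 => /eqP ->.
have [i mi] : exists i, (0 < m i)%N.
  apply/existsP; apply: contra_eqT mn => /existsPn m0.
  by rewrite mdegE big1 // => i _; apply/eqP; rewrite -leqn0 leqNgt m0.
have mE : m = (U_(i) + (m - U_(i)))%MM.
  rewrite addmC submK //; apply/mnm_lepP => j; rewrite mnm1E.
  by case: eqP => // <-.
rewrite mE; apply: TS; apply: IH; apply/eqP.
by rewrite -eqSS -mn {2}mE mdegD mdeg1.
Qed.

(** An index set independent of the support allows termwise proofs of symmetry and linearity. *)
Lemma apolarwE n P Q : (msize P <= n)%N ->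
  apolar P Q = \sum_(m : 'X_{1..d < n}) (mfact m)%:R * P@_m * conjc Q@_m.
Proof.
move=> Pn; rewrite /apolar (big_mksub 'X_{1..d < n}) ?msupp_uniq //=; last first.
  by move=> m /msize_mdeg_lt /leq_trans; apply.
rewrite big_rmcond //= => m /memN_msupp_eq0 ->.
by rewrite mulr0 mul0r.
Qed.

Lemma apolarC P Q : apolar Q P = conjc (apolar P Q).
Proof.
pose n := maxn (msize P) (msize Q).
rewrite (apolarwE _ (leq_maxl _ _ : _ <= n)%N) (apolarwE _ (leq_maxr _ _ : _ <= n)%N).
rewrite rmorph_sum; apply: eq_bigr => m _.
by rewrite !rmorphM /= conjcK conjc_nat mulrAC.
Qed.

Lemma apolarPl a P Q f : apolar (a *: P + Q) f = a * apolar P f + apolar Q f.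
Proof.
pose n := maxn (msize (a *: P + Q)) (maxn (msize P) (msize Q)).
rewrite !(@apolarwE n) ?leq_max ?leqnn ?orbT // mulr_sumr -big_split /=.
by apply: eq_bigr => m _; rewrite mcoeffD mcoeffZ; ring.
Qed.

Lemma apolar0l Q : apolar 0 Q = 0.
Proof. by rewrite /apolar msupp0 big_nil. Qed.

Lemma apolarZl a P Q : apolar (a *: P) Q = a * apolar P Q.
Proof. by have := apolarPl a P 0 Q; rewrite addr0 apolar0l addr0. Qed.

Lemma apolarDl P Q f : apolar (P + Q) f = apolar P f + apolar Q f.
Proof. by have := apolarPl 1 P Q f; rewrite scale1r mul1r. Qed.

Lemma apolar0r P : apolar P 0 = 0.
Proof. by rewrite apolarC apolar0l rmorph0. Qed.

Lemma apolarZr a P Q : apolar P (a *: Q) = conjc a * apolar P Q.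
Proof. by rewrite apolarC apolarZl rmorphM /= -apolarC. Qed.

Lemma apolarDr P Q f : apolar P (Q + f) = apolar P Q + apolar P f.
Proof. by rewrite apolarC apolarDl rmorphD /= -!apolarC. Qed.

Lemma apolar_suml (I : Type) (s : seq I) (F : I -> {mpoly R[i][d]}) Q :
  apolar (\sum_(i <- s) F i) Q = \sum_(i <- s) apolar (F i) Q.
Proof.
elim: s => [|i s IH]; first by rewrite !big_nil apolar0l.
by rewrite !big_cons apolarDl IH.
Qed.

Lemma apolar_sumr (I : Type) (s : seq I) (F : I -> {mpoly R[i][d]}) Q :
  apolar Q (\sum_(i <- s) F i) = \sum_(i <- s) apolar Q (F i).
Proof.
elim: s => [|i s IH]; first by rewrite !big_nil apolar0r.
by rewrite !big_cons apolarDr IH.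
Qed.

Lemma apolarX m Q : apolar 'X_[m] Q = (mfact m)%:R * conjc Q@_m.
Proof. by rewrite /apolar msuppX big_seq1 mcoeffX eqxx mulr1. Qed.

(** Multiplication by a variable is adjoint to differentiation; on monomials this is the recursion
    [mfactS]. *)
Lemma apolar_mulX i P Q : apolar ('X_i * P) Q = apolar P Q^`M(i).
Proof.
elim/mpolyind: P => [|a m P _ _ IH]; first by rewrite mulr0 !apolar0l.
rewrite mulrDr -scalerAr !apolarPl IH; congr (_ * _ + _).
rewrite -mpolyXD addmC !apolarX mcoeff_deriv mfactS.
by rewrite rmorphMn /= natrM -mulr_natl; ring.
Qed.

Definition apolar_sq P : R := complex.Re (apolar P P).

Lemma apolar_sqE P : apolar_sq P = \sum_(m <- msupp P) (mfact m)%:R * normc P@_m ^+ 2.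
Proof.
rewrite /apolar_sq /apolar raddf_sum; apply: eq_bigr => m _ /=.
by rewrite normc_sqrJ -mulrA -(rmorph_nat (real_complex R)) Re_mulCl.
Qed.

Lemma apolar_sq_ge0 P : 0 <= apolar_sq P.
Proof. by rewrite apolar_sqE; apply: sumr_ge0 => m _; rewrite mulr_ge0 ?ler0n ?sqr_ge0. Qed.

Lemma apolar_sqC P : (apolar_sq P)%:C%C = apolar P P.
Proof.
have : complex.Im (apolar P P) = 0.
  by have := apolarC P P; case: (apolar P P) => x y [/eqP]; rewrite -addr_eq0 -mulr2n mulrn_eq0 => /eqP.
by rewrite /apolar_sq; case: (apolar P P) => x y /= ->.
Qed.

Lemma euler_homog n P : P \is n.-homog -> \sum_i 'X_i * P^`M(i) = n%:R *: P.
Proof.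
move=> /dhomogP homP; rewrite [P in RHS]mpolyE scaler_sumr.
under eq_bigr do rewrite /mderiv mulr_sumr.
rewrite exchange_big /=; apply: eq_big_seq => m mP.
under eq_bigr do rewrite -scalerAr mulrC -scalerA.
have <- : mdeg m = n by exact: homP.
rewrite mdegE natr_sum scaler_suml; apply: eq_bigr => i _.
(* Subtraction of multi-indices truncates, so a zero exponent is set apart; its coefficient kills
   the term. *)
rewrite !scalerA [_ * P@_m]mulrC; have [->|mi] := eqVneq (m i) 0%N.
  by rewrite !mulr0 !scale0r.
congr (_ *: _); rewrite mulrC -mpolyXD submK //; apply/mnm_lepP => j; rewrite mnm1E.
by case: eqP => // <-; rewrite lt0n.
Qed.

Lemma mderiv_homog0 i P : P \is 0.-homog -> P^`M(i) = 0.
Proof.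
move=> homP; apply/mpolyP => m; rewrite mcoeff_deriv mcoeff0.
by rewrite (dhomog_nemf_coeff homP) ?mul0rn //= mdegD mdeg1 addn1.
Qed.

Lemma dhomog_mderiv n i P : P \is n.-homog -> P^`M(i) \is n.-1.-homog.
Proof.
case: n => [/mderiv_homog0 ->|n homP]; first exact: rpred0.
apply/dhomogP => m; rewrite mcoeff_msupp mcoeff_deriv.
apply: contraNeq => mn; rewrite (dhomog_nemf_coeff homP) ?mul0rn //=.
by rewrite mdegD mdeg1 addn1.
Qed.

Lemma dhomog_mderivm n P m : P \is (mdeg m + n).-homog -> P^`M[m] \is n.-homog.
Proof.
move=> homP; apply/dhomogP => m'; rewrite mcoeff_msupp mcoeff_mderivm.
apply: contraNeq => mn; rewrite (dhomog_nemf_coeff homP) ?mul0rn //=.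
by rewrite mdegD eqn_add2l.
Qed.

(** By adjointness, [|X_i P|^2 = <P, d_i (X_i P)> = |P|^2 + <P, X_i d_i P>]; summing over [i],
    Euler's identity turns the last terms into [n |P|^2]. *)
Lemma apolar_sq_mulX_sum n P : P \is n.-homog ->
  \sum_i apolar_sq ('X_i * P) = (n + d)%:R * apolar_sq P.
Proof.
move=> homP; apply: (@complexI R); rewrite rmorph_sum /=.
under eq_bigr => i _.
  rewrite apolar_sqC apolar_mulX mderivM mderivX mnm1E eqxx scale1r.
  rewrite -{1}[U_(i)%MM]add0m addmK mpolyX0 mul1r apolarDr; over.
rewrite big_split /= -(apolar_sumr _ (fun i => 'X_i * P^`M(i))) (euler_homog homP) apolarZr sumr_const card_ord.
by rewrite conjc_nat rmorphM rmorph_nat /= apolar_sqC natrD mulrDl addrC !mulr_natl.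
Qed.

End Apolar.

(** * Positivity of the Gaussian functional *)

Section Positivity.
Variables (R : realType) (d : nat).
Implicit Types (f g : {mpoly R[i][d]}) (z : 'I_d -> R[i]) (S : seq 'I_d).
Implicit Types (a b : 'X_{1..d}).
Local Notation normc := Normc.normc.

(* The monomial [z^a * conj z^b] with the variables in [S] integrated out
   against the Gaussian measure. *)
Definition gauss_monomial S z a b : R[i] :=
  \prod_j (if j \in S then (a j == b j)%:R * (a j)`!%:R
           else z j ^+ a j * conjc (z j) ^+ b j).

Lemma gauss_monomial0 z a b :
  gauss_monomial [::] z a b = ('X_[a]).@[z] * conjc ('X_[b]).@[z].
Proof.
rewrite !mevalX rmorph_prod -big_split /=; apply: eq_bigr => j _.
by rewrite rmorphXn.
Qed.

Lemma gauss_monomialT S z a b : (forall j, j \in S) ->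
  gauss_monomial S z a b = (a == b)%:R * (mfact a)%:R.
Proof.
move=> ST; rewrite /gauss_monomial; under eq_bigr do rewrite ST.
have [<-|ab] := eqVneq.
  by rewrite mul1r /mfact natr_prod; apply: eq_bigr => j _; rewrite eqxx mul1r.
have [j jP] : exists j, a j != b j.
  by apply/existsP; rewrite -negb_forall; apply: contra ab => /forallP h; apply/eqP/mnmP => j; apply/eqP.
by rewrite (bigD1 j) //= (negPf jP) !mul0r.
Qed.

(** The variables of [T] are integrated out one at a time by [gauss_moment_ge0]. The free
    coefficients in [K] allow several polynomials and negative weights. *)
Lemma gauss_monomial_sum_ge0 (K : seq (R[i] * ('X_{1..d} * 'X_{1..d}))) S T :
  (forall z, 0 <= complex.Re (\sum_(x <- K) x.1 * gauss_monomial S z x.2.1 x.2.2)) ->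
  forall z, 0 <= complex.Re (\sum_(x <- K) x.1 * gauss_monomial (T ++ S) z x.2.1 x.2.2).
Proof.
move=> HS; elim: T => [//|i T HT] z; rewrite cat_cons; set U := T ++ S in HT *.
have [iU|iU] := boolP (i \in U).
  rewrite (eq_bigr (fun x => x.1 * gauss_monomial U z x.2.1 x.2.2)) // => x _.
  congr (_ * _); apply: eq_bigr => j _; rewrite inE.
  by case: eqP => // ->; rewrite iU.
(* With all other variables frozen or already integrated, [rest x] is the coefficient of a monomial
   in the [i]-th variable. *)
pose rest (x : R[i] * ('X_{1..d} * 'X_{1..d})) :=
  x.1 * \prod_(j | j != i) (if j \in U then (x.2.1 j == x.2.2 j)%:R * (x.2.1 j)`!%:R
           else z j ^+ x.2.1 j * conjc (z j) ^+ x.2.2 j).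
have := @gauss_moment_ge0 _ _ K rest (fun x => x.2.1 i) (fun x => x.2.2 i).
rewrite (eq_bigr (fun x => x.1 * gauss_monomial (i :: U) z x.2.1 x.2.2)); last first.
  move=> x _; rewrite /gauss_monomial (bigD1 i) //= mem_head /rest -mulrA; congr (_ * _).
  rewrite mulrC; congr (_ * _); apply: eq_bigr => j ji.
  by rewrite inE (negPf ji).
apply=> t; have := HT (fun j => if j == i then t else z j).
rewrite (eq_bigr (fun x => rest x * (t ^+ x.2.1 i * conjc t ^+ x.2.2 i))) //.
move=> x _; rewrite /gauss_monomial (bigD1 i) //= (negPf iU) eqxx /rest -mulrA.
congr (_ * _); rewrite mulrC; congr (_ * _); apply: eq_bigr => j ji.
by rewrite (negPf ji).
Qed.

(* [|f|^2] with the variables in [S] integrated out. *)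
Definition gauss_sq S z f : R[i] :=
  \sum_(a <- msupp f) \sum_(b <- msupp f) f@_a * conjc f@_b * gauss_monomial S z a b.

Lemma gauss_sq0 z f : gauss_sq [::] z f = (normc f.@[z] ^+ 2)%:C%C.
Proof.
have -> : (normc f.@[z] ^+ 2)%:C%C = f.@[z] * conjc f.@[z].
  by rewrite normc_sqrJ; case: f.@[z] => x y; congr Complex; rewrite /=; ring.
rewrite mevalE rmorph_sum big_distrlr /=; apply: eq_bigr => a _; apply: eq_bigr => b _.
by rewrite gauss_monomial0 !mevalX rmorphM mulrACA.
Qed.

Lemma gauss_sqT S z f : (forall j, j \in S) -> gauss_sq S z f = apolar f f.
Proof.
move=> ST; apply: eq_big_seq => a af; rewrite (bigD1_seq a) ?msupp_uniq //= big1_seq ?addr0.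
  by rewrite gauss_monomialT // eqxx mul1r; ring.
by move=> b /andP[/negPf ba _]; rewrite gauss_monomialT // eq_sym ba mul0r mulr0.
Qed.

(** Integrating out the remaining variables preserves positivity. An empty [S] gives the pointwise
    criterion, and a singleton [S] the criterion on slices. *)
Lemma gauss_sq_sum_ge0 (I : Type) (s : seq I) (w : I -> R) (F : I -> {mpoly R[i][d]}) S :
  (forall z, 0 <= \sum_(x <- s) w x * complex.Re (gauss_sq S z (F x))) ->
  0 <= \sum_(x <- s) w x * apolar_sq (F x).
Proof.
pose K := [seq ((w y.1)%:C%C * ((F y.1)@_y.2.1 * conjc (F y.1)@_y.2.2), y.2) |
            y <- [seq (x, ab) | x <- s, ab <- [seq (a, b) | a <- msupp (F x), b <- msupp (F x)]]].
have KE U z : \sum_(x <- s) w x * complex.Re (gauss_sq U z (F x))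
    = complex.Re (\sum_(x <- K) x.1 * gauss_monomial U z x.2.1 x.2.2).
  rewrite /K big_map big_allpairs_dep raddf_sum; apply: eq_bigr => x _ /=.
  rewrite big_allpairs_dep /= -Re_mulCl; congr complex.Re.
  rewrite mulr_sumr; apply: eq_bigr => a _; rewrite mulr_sumr; apply: eq_bigr => b _.
  by rewrite !mulrA.
have T_full j : j \in enum 'I_d ++ S by rewrite mem_cat mem_enum.
move=> HS; have := @gauss_monomial_sum_ge0 K S (enum 'I_d).
(* Once every variable is integrated out, the evaluation point is arbitrary. *)
move=> /(_ _ (fun=> 0)); rewrite -KE.
under eq_bigr do rewrite gauss_sqT //.
by apply=> z; rewrite -KE.
Qed.

Lemma apolar_sq_sum_ge0 (I : Type) (s : seq I) (w : I -> R) (F : I -> {mpoly R[i][d]}) :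
  (forall z, 0 <= \sum_(x <- s) w x * normc (F x).@[z] ^+ 2) ->
  0 <= \sum_(x <- s) w x * apolar_sq (F x).
Proof.
move=> H; apply: (@gauss_sq_sum_ge0 _ _ _ _ [::]) => z.
by under eq_bigr do rewrite gauss_sq0; exact: H.
Qed.

End Positivity.

(** * Derivatives of a factor *)

Section KeyInequality.
Variables (R : realType) (d : nat).
Implicit Types (f g P : {mpoly R[i][d]}) (z : 'I_d -> R[i]) (a b : 'X_{1..d}).
Local Notation normc := Normc.normc.

(** The exponents may repeat, since distinct monomials in several variables can have the same degree
    in one of them; hence the double sum. *)
Lemma gauss_norm_sumX (I : eqType) (s : seq I) (c : I -> R[i]) (e : I -> nat) :
  (gauss_norm (\sum_(x <- s) c x *: 'X^(e x)))%:C%C =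
  \sum_(x <- s) \sum_(y <- s) c x * conjc (c y) * ((e x == e y)%:R * (e x)`!%:R).
Proof.
pose N := (\max_(x <- s) e x).+1; set p := \sum_(x <- s) _ *: 'X^_.
have ltN x : x \in s -> (e x < N)%N.
  by move=> xs; rewrite ltnS (@leq_bigmax_seq _ s xpredT e).
have pN : (size p <= N)%N.
  rewrite (leq_trans (size_sum _ _ _)) //; apply/bigmax_leqP_seq => x xs _.
  by rewrite (leq_trans (size_scale_leq _ _)) // size_polyXn ltN.
have coefp n : p`_n = \sum_(x <- s) c x * (e x == n)%:R.
  by rewrite coef_sum; apply: eq_bigr => x _; rewrite coefZ coefXn eq_sym.
rewrite (gauss_normE pN) rmorph_sum /=.
transitivity (\sum_(n < N) \sum_(x <- s) \sum_(y <- s)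
    c x * conjc (c y) * ((e x == n)%:R * (e y == n)%:R * n`!%:R)).
  apply: eq_bigr => n _.
  have -> : (n`!%:R * normc p`_n ^+ 2)%:C%C = n`!%:R * (p`_n * conjc p`_n).
    rewrite rmorphM rmorph_nat; congr (_ * _); rewrite normc_sqrJ.
    by case: p`_n => x y; congr Complex; rewrite /=; ring.
  rewrite coefp rmorph_sum big_distrlr mulr_sumr; apply: eq_bigr => x _.
  rewrite mulr_sumr; apply: eq_bigr => y _.
  by rewrite rmorphM /= conjc_nat; ring.
rewrite exchange_big; apply: eq_big_seq => x xs.
rewrite exchange_big; apply: eq_bigr => y _ /=.
rewrite (bigD1 (Ordinal (ltN x xs))) //= big1 ?addr0; last first.
  by move=> n /negPf xn; rewrite -val_eqE /= eq_sym in xn; rewrite xn !mul0r mulr0.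
by rewrite eqxx mul1r eq_sym.
Qed.

Definition slice i z : {mpoly R[i][d]} -> {poly R[i]} :=
  mmap polyC (fun j => if j == i then 'X else (z j)%:P).

Lemma sliceD i z f g : slice i z (f + g) = slice i z f + slice i z g.
Proof. exact: mmapD. Qed.

Lemma sliceZ i z c f : slice i z (c *: f) = c *: slice i z f.
Proof. by rewrite /slice mmapZ mul_polyC. Qed.

Lemma sliceM i z f g : slice i z (f * g) = slice i z f * slice i z g.
Proof. by rewrite /slice rmorphM. Qed.

Lemma sliceX i z a :
  slice i z 'X_[a] = (\prod_(j | j != i) z j ^+ a j) *: 'X^(a i).
Proof.
rewrite /slice mmapX /mmap1 (bigD1 i) //= eqxx mulrC -mul_polyC rmorph_prod.
congr (_ * _); apply: eq_bigr => j /negPf ji.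
by rewrite ji rmorphXn.
Qed.

Lemma sliceE i z f :
  slice i z f = \sum_(a <- msupp f) (f@_a * \prod_(j | j != i) z j ^+ a j) *: 'X^(a i).
Proof.
rewrite {1}[f]mpolyE /slice raddf_sum; apply: eq_bigr => a _ /=.
by rewrite -/(slice i z _) sliceZ sliceX scalerA.
Qed.

Lemma gauss_sq_slice i z f :
  gauss_sq [:: i] z f = (gauss_norm (slice i z f))%:C%C.
Proof.
rewrite sliceE gauss_norm_sumX; apply: eq_bigr => a _; apply: eq_bigr => b _.
rewrite /gauss_monomial (bigD1 i) //= mem_head rmorphM rmorph_prod /=.
under eq_bigr => j ji do rewrite inE (negPf ji).
rewrite big_split /=.
under [X in _ = _ * (_ * X) * _]eq_bigr do rewrite rmorphXn /=.
ring.
Qed.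

Lemma slice_mderiv i z f : slice i z f^`M(i) = (slice i z f)^`().
Proof.
elim/mpolyind: f => [|c a f _ _ IH]; first by rewrite mderiv0 /slice mmap0 linear0.
rewrite mderivD mderivZ mderivX !sliceD derivD IH; congr (_ + _).
rewrite !sliceZ !sliceX !derivZ derivXn.
rewrite mnmBE mnm1E eqxx subn1 -[in RHS]scaler_nat !scalerA.
congr (_ *: _); rewrite -!mulrA; congr (_ * _); rewrite mulrC; congr (_ * _).
by apply: eq_bigr => j /negPf ji; rewrite mnmBE mnm1E eq_sym ji subn0.
Qed.

Lemma size_slice i z n f : f \is n.-homog -> (size (slice i z f) <= n.+1)%N.
Proof.
move=> /dhomogP homf; rewrite sliceE (leq_trans (size_sum _ _ _)) //.
apply/bigmax_leqP_seq => a af _.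
rewrite (leq_trans (size_scale_leq _ _)) // size_polyXn ltnS.
by rewrite -(homf a af) /= mdegE (bigD1 i) //= leq_addr.
Qed.

(** Positivity is applied to the difference of the two sides after integrating out the [i]-th
    variable alone: there it is [gauss_norm_deriv] on each slice. *)
Lemma apolar_sq_mderiv_mul n i P f : P \is n.-homog ->
  apolar_sq (P^`M(i) * f) <= n%:R ^+ 2 * apolar_sq (P * f).
Proof.
move=> homP; pose s := [:: (n%:R ^+ 2 : R, P * f); (-1, P^`M(i) * f)].
have := @gauss_sq_sum_ge0 R d _ s fst snd [:: i].
rewrite !big_cons big_nil /= addr0 mulN1r subr_ge0; apply=> z.
rewrite !big_cons big_nil /= addr0 mulN1r subr_ge0 !gauss_sq_slice /=.
rewrite !sliceM slice_mderiv.
exact: gauss_norm_deriv (size_slice i z homP).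
Qed.

(** Each differentiation costs the square of the current degree, which is at most [n]. *)
Lemma apolar_sq_mderivm_mul n a P f : P \is n.-homog ->
  apolar_sq (P^`M[a] * f) <= n%:R ^+ (2 * mdeg a) * apolar_sq (P * f).
Proof.
elim/mnm_ind: a n P => [|i a IH] n P homP.
  by rewrite mderivm0m mdeg0 muln0 mul1r.
rewrite mderivmDm mderivmU1m (le_trans (IH _ _ (dhomog_mderiv i homP))) //.
rewrite mdegD mdeg1 mulnDr exprD muln1 [_ ^+ 2 * _]mulrC -mulrA.
apply: ler_pM; rewrite ?exprn_ge0 ?ler0n ?apolar_sq_ge0 //.
  by rewrite lerXn2r ?nnegrE ?ler0n // ler_nat leq_pred.
exact: apolar_sq_mderiv_mul.
Qed.

End KeyInequality.

(** * The lower bound *)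

Section LowerBound.
Variables (R : realType) (d : nat).
Implicit Types (f g P : {mpoly R[i][d]}) (z : 'I_d -> R[i]) (a b : 'X_{1..d}).
Local Notation normc := Normc.normc.

(* Iterating [n] times from [[:: f]] gives the products of [f] with all words of
   length [n] in the variables; their squared moduli add up to
   [|z| ^ (2 n) * |f z| ^ 2]. *)
Definition mulX_all (s : seq {mpoly R[i][d]}) :=
  [seq 'X_i * g | g <- s, i <- enum 'I_d].

Lemma normc_mulX_all z s :
  \sum_(g <- mulX_all s) normc g.@[z] ^+ 2 =
    (\sum_i normc (z i) ^+ 2) * \sum_(g <- s) normc g.@[z] ^+ 2.
Proof.
rewrite big_allpairs_dep mulr_sumr; apply: eq_bigr => g _.
rewrite big_enum mulr_suml; apply: eq_bigr => i _.
by rewrite mevalM mevalXU Normc.normcM exprMn.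
Qed.

Lemma apolar_sq_mulX_all m s : {in s, forall g, g \is m.-homog} ->
  \sum_(g <- mulX_all s) apolar_sq g = (m + d)%:R * \sum_(g <- s) apolar_sq g.
Proof.
move=> homs; rewrite big_allpairs_dep mulr_sumr; apply: eq_big_seq => g gs.
by rewrite big_enum; exact: apolar_sq_mulX_sum (homs g gs).
Qed.

Lemma dhomog_mulX_all m s : {in s, forall g, g \is m.-homog} ->
  {in mulX_all s, forall g, g \is m.+1.-homog}.
Proof.
move=> homs _ /allpairsP[[g i] [/= gs _ ->]].
by rewrite -add1n dhomogM ?homs // dhomogX /= mdeg1.
Qed.

(** The pass from words of length [j] to length [j + 1] multiplies the sum by exactly [m + j + d],
    which is at least [m + d]. *)
Lemma apolar_sq_iter_mulX m n f : f \is m.-homog ->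
  (m + d)%:R ^+ n * apolar_sq f <= \sum_(g <- iter n mulX_all [:: f]) apolar_sq g.
Proof.
move=> homf; have homs j : {in iter j mulX_all [:: f], forall g, g \is (m + j).-homog}.
  elim: j => [|j IH]; first by move=> g; rewrite inE addn0 => /eqP ->.
  by rewrite iterS addnS; exact: dhomog_mulX_all.
elim: n => [|n IH]; first by rewrite big_seq1 mul1r.
rewrite iterS (apolar_sq_mulX_all (homs n)) exprS -mulrA.
apply: ler_pM => //; rewrite ?mulr_ge0 ?exprn_ge0 ?ler0n ?apolar_sq_ge0 //.
by rewrite ler_nat leq_add2r leq_addr.
Qed.

Lemma meval_homog n P z (c : R[i]) : P \is n.-homog ->
  P.@[fun i => c * z i] = c ^+ n * P.@[z].
Proof.
move=> /dhomogP homP; rewrite !mevalE mulr_sumr; apply: eq_big_seq => a aP.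
under eq_bigr do rewrite exprMn.
have <- : mdeg a = n by exact: homP.
by rewrite big_split /= mdegE -expr_sum; ring.
Qed.

Lemma deriv_normE rho P (z : 'rV[R[i]]_d) :
  deriv_norm rho P z ^+ 2 =
  \sum_(a : 'X_{1..d < rho.+1} | mdeg a == rho) normc (P^`M[a]).@[z 0] ^+ 2.
Proof. by rewrite sqr_sqrtr // sumr_ge0 // => a _; exact: sqr_ge0. Qed.

(** The derivatives are homogeneous of degree [n + 1], so a nonzero [z] can be scaled to the sphere;
    at [z = 0] the positive exponent makes the left side vanish. *)
Lemma sphere_min_le rho P z n : P \is (rho + n.+1).-homog -> (0 < d)%N ->
  sphere_min (deriv_norm rho P) ^+ 2 * (\sum_i normc (z i) ^+ 2) ^+ n.+1
  <= \sum_(a : 'X_{1..d < rho.+1} | mdeg a == rho) normc (P^`M[a]).@[z] ^+ 2.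
Proof.
move=> homP d_gt0; set N := \sum_i _.
have [->|N_neq0] := eqVneq N 0.
  by rewrite expr0n mulr0 sumr_ge0 // => a _; exact: sqr_ge0.
have N_gt0 : 0 < N by rewrite lt0r N_neq0 sumr_ge0 // => i _; exact: sqr_ge0.
pose r := Num.sqrt N; have r_gt0 : 0 < r by rewrite sqrtr_gt0.
pose eta : 'rV[R[i]]_d := \row_i (r^-1%:C%C * z i).
have eta1 : csphere R d eta.
  rewrite /csphere /= /hnorm -[RHS]sqrtr1; congr Num.sqrt.
  rewrite /herm raddf_sum /=.
  under eq_bigr => i _ do rewrite mxE -normc_sqrJ Normc.normcM exprMn.
  rewrite -mulr_sumr -/N normc_sqrE /= expr0n addr0 exprVn sqr_sqrtr ?ltW //.
  by rewrite mulVf.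
have min_le : sphere_min (deriv_norm rho P) <= deriv_norm rho P eta.
  apply: ge_inf; last by exists eta.
  by exists 0 => _ [? _ <-]; exact: sqrtr_ge0.
have min_ge0 : 0 <= sphere_min (deriv_norm rho P).
  by have [w _ <-] := sphere_min_attained rho P d_gt0; exact: sqrtr_ge0.
have : sphere_min (deriv_norm rho P) ^+ 2 <= deriv_norm rho P eta ^+ 2.
  by rewrite lerXn2r // ?nnegrE // sqrtr_ge0.
rewrite deriv_normE; under eq_bigr => a arho.
  rewrite (_ : (P^`M[a]).@[eta 0] = (r^-1%:C%C) ^+ n.+1 * (P^`M[a]).@[z]); last first.
    rewrite -meval_homog; first by apply: meval_eq => i; rewrite mxE.
    by apply: dhomog_mderivm; rewrite (eqP arho).
  rewrite Normc.normcM exprMn -rmorphXn /= expr0n addr0 sqr_sqrtr ?sqr_ge0 //.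
  over.
have -> : (r^-1 ^+ n.+1) ^+ 2 = (N ^+ n.+1)^-1.
  by rewrite -exprM mulnC exprM exprVn sqr_sqrtr ?exprVn // ltW.
by rewrite -mulr_sumr ler_pdivlMl ?exprn_gt0 // mulrC.
Qed.

Lemma card_mdeg_eq rho : (0 < d)%N ->
  (#|[pred a : 'X_{1..d < rho.+1} | mdeg a == rho]| <= 'C(d + rho - 1, rho))%N.
Proof.
case: d => // e _; rewrite addSn subn1 /= addnC -size_basis cardE.
rewrite -(size_map (@bmnm _ _)) uniq_leq_size //.
  by rewrite map_inj_uniq ?enum_uniq //; exact: val_inj.
by move=> _ /mapP[a + ->]; rewrite mem_enum inE basis_cover.
Qed.

(** Both sides are compared with [A]: from above by the bound on each derivative and the number of
    multi-indices, from below by the minimum on the sphere. *)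
Lemma apolar_sq_mul_ge k rho m P f : (rho < k)%N -> (0 < d)%N ->
  P \is k.-homog -> f \is m.-homog ->
  sphere_min (deriv_norm rho P) ^+ 2 * (m + d)%:R ^+ (k - rho) * apolar_sq f
  <= 'C(d + rho - 1, rho)%:R * (k%:R ^+ (2 * rho) * apolar_sq (P * f)).
Proof.
move=> rho_lt_k d_gt0 homP homf; set M := sphere_min _.
pose A := \sum_(a : 'X_{1..d < rho.+1} | mdeg a == rho) apolar_sq (P^`M[a] * f).
apply: (@le_trans _ _ A); last first.
  apply: (@le_trans _ _ (\sum_(a : 'X_{1..d < rho.+1} | mdeg a == rho)
      (k%:R ^+ (2 * rho) * apolar_sq (P * f)))).
    by apply: ler_sum => a /eqP arho; rewrite -[X in (2 * X)%N]arho; exact: apolar_sq_mderivm_mul.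
  rewrite sumr_const -[leLHS]mulr_natl ler_wpM2r //.
    by rewrite mulr_ge0 ?exprn_ge0 ?ler0n ?apolar_sq_ge0.
  by rewrite ler_nat card_mdeg_eq.
(* The weights [1] and [- M ^+ 2] encode a pointwise inequality between sums of squares, ready for
   [apolar_sq_sum_ge0]. *)
pose n := (k - rho)%N; pose s :=
  [seq (1 : R, P^`M[bmnm a] * f) | a : 'X_{1..d < rho.+1} <- enum [pred a : 'X_{1..d < rho.+1} | mdeg a == rho]]
  ++ [seq (- M ^+ 2, g) | g <- iter n mulX_all [:: f]].
have := @apolar_sq_sum_ge0 R d _ s fst snd.
rewrite !big_cat !big_map /= big_enum /= -!mulr_sumr mul1r.
move=> H; rewrite -mulrA.
apply: le_trans (ler_wpM2l (sqr_ge0 M) (apolar_sq_iter_mulX n homf)) _.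
rewrite -subr_ge0 -mulNr; apply: H => z.
rewrite !big_cat !big_map /= big_enum /= -!mulr_sumr mul1r.
under eq_bigr do rewrite mevalM Normc.normcM exprMn.
rewrite -mulr_suml mulNr subr_ge0.
have -> : \sum_(g <- iter n mulX_all [:: f]) normc g.@[z] ^+ 2 =
    (\sum_i normc (z i) ^+ 2) ^+ n * normc f.@[z] ^+ 2.
  elim: n {s} => [|n IH]; first by rewrite big_seq1 mul1r.
  by rewrite iterS normc_mulX_all IH mulrA -exprS.
rewrite mulrA ler_wpM2r ?sqr_ge0 //.
have nS : n = n.-1.+1 by rewrite prednK // subn_gt0.
rewrite nS; apply: sphere_min_le => //.
by rewrite -nS subnKC // ltnW.
Qed.

End LowerBound.

(** * The upper bound *)

Section UpperBound.
Variables (R : realType) (d : nat) (c : 'rV[R[i]]_d).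
Implicit Types (f g P Q : {mpoly R[i][d]}) (a b : 'X_{1..d}).
Local Notation normc := Normc.normc.
Local Notation l := (herm_poly c).

(* The adjoint of the multiplication by [<z, c>]. *)
Definition dir_deriv P := \sum_i c 0 i *: P^`M(i).

Lemma dir_deriv_is_linear : linear dir_deriv.
Proof.
move=> a P Q; rewrite /dir_deriv scaler_sumr -big_split; apply: eq_bigr => i _ /=.
by rewrite mderivD mderivZ scalerDr !scalerA mulrC.
Qed.

HB.instance Definition _ := GRing.isLinear.Build R[i] {mpoly R[i][d]}
  {mpoly R[i][d]} _ dir_deriv dir_deriv_is_linear.

Lemma dir_derivM P Q : dir_deriv (P * Q) = dir_deriv P * Q + P * dir_deriv Q.
Proof.
rewrite /dir_deriv mulr_suml mulr_sumr -big_split; apply: eq_bigr => i _ /=.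
by rewrite mderivM scalerDr scalerAl scalerAr.
Qed.

Lemma apolar_mul_herm_poly P Q : apolar (l * P) Q = apolar P (dir_deriv Q).
Proof.
rewrite /herm_poly mulr_suml apolar_suml apolar_sumr; apply: eq_bigr => i _.
by rewrite -scalerAl apolarZl apolarZr apolar_mulX.
Qed.

Lemma apolar_mul_herm_polyX n P Q :
  apolar (l ^+ n * P) Q = apolar P (iter n dir_deriv Q).
Proof.
elim: n Q => [|n IH] Q; first by rewrite mul1r.
by rewrite exprS -mulrA apolar_mul_herm_poly IH -iterSr.
Qed.

(** Leibniz' rule; the induction step splits the binomials by Pascal's rule and shifts one of the
    two sums. *)
Lemma iter_dir_derivM n P Q :
  iter n dir_deriv (P * Q) =
  \sum_(j < n.+1) (iter (n - j) dir_deriv P * iter j dir_deriv Q) *+ 'C(n, j).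
Proof.
elim: n P Q => [|n IH] P Q; first by rewrite big_ord1.
rewrite iterS IH raddf_sum /=.
under eq_bigr do rewrite raddfMn /= dir_derivM mulrnDl -!iterS.
rewrite big_split /= [RHS]big_ord_recl [X in X + _ = _]big_ord_recl !subn0 !bin0 -addrA.
congr (_ + _).
under [RHS]eq_bigr do rewrite lift0 subSS binS mulrnDr.
rewrite big_split /=; congr (_ + _).
rewrite [RHS]big_ord_recr bin_small // mulr0n /= addr0.
by apply: eq_bigr => j _; rewrite /bump /= add1n -iterS subnSK.
Qed.

Lemma dhomog_dir_deriv n P : P \is n.-homog -> dir_deriv P \is n.-1.-homog.
Proof. by move=> homP; apply: rpred_sum => i _; rewrite rpredZ // dhomog_mderiv. Qed.

Lemma dhomog_iter_dir_deriv n j P :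
  P \is n.-homog -> iter j dir_deriv P \is (n - j).-homog.
Proof.
move=> homP; elim: j => [|j IH]; first by rewrite subn0.
by rewrite subnS; exact: dhomog_dir_deriv.
Qed.

Lemma iter_dir_deriv_eq0 n j P : P \is n.-homog -> (n < j)%N ->
  iter j dir_deriv P = 0.
Proof.
move=> homP nj; rewrite -(subnK nj) iterD iterS.
have -> : dir_deriv (iter n dir_deriv P) = 0.
  have := dhomog_iter_dir_deriv n homP; rewrite subnn => hom0.
  by rewrite /dir_deriv big1 // => i _; rewrite mderiv_homog0 ?scaler0.
by elim: (j - _)%N => //= i ->; rewrite linear0.
Qed.

Lemma meval_dir_deriv n P : P \is n.-homog ->
  (dir_deriv P).@[c 0] = n%:R * P.@[c 0].
Proof.
move=> homP; rewrite -mevalZ -(euler_homog homP) !raddf_sum /=.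
by apply: eq_bigr => i _; rewrite mevalZ mevalM mevalXU.
Qed.

(** By Euler's identity at [c], each derivative along [c] contributes the current degree as a
    factor, down to a constant. *)
Lemma iter_dir_deriv_coef0 n P : P \is n.-homog ->
  (iter n dir_deriv P)@_0%MM = n`!%:R * P.@[c 0].
Proof.
elim: n P => [|n IH] P homP.
  have {2}-> : P = (P@_0%MM)%:MP; last by rewrite mul1r mevalC.
  apply/mpolyP => a; rewrite mcoeffC; have [->|a0] := eqVneq a 0%MM.
    by rewrite mulr1.
  by rewrite mulr0 (dhomog_nemf_coeff homP) //= mdeg_eq0.
rewrite iterSr IH ?(dhomog_dir_deriv homP) // (meval_dir_deriv homP).
by rewrite factS natrM mulrCA mulrA.
Qed.

Lemma iter_dir_deriv_mderivm j a P :
  (iter j dir_deriv P)^`M[a] = iter j dir_deriv P^`M[a].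
Proof.
elim: j => //= j <-; rewrite /dir_deriv raddf_sum; apply: eq_bigr => i _ /=.
by rewrite mderivmZ -!mderivmU1m -!mderivmDm addmC.
Qed.

(** For [|a| = k - j], the coefficient of [g] at [a] times [a!] is the constant
    [d^a g = D^j (d^a P)], which is [j!] times the value of [d^a P] at [c]. *)
Lemma apolar_sq_iter_dir_deriv k j P : P \is k.-homog -> (j <= k)%N ->
  apolar_sq (iter j dir_deriv P) =
  j`!%:R ^+ 2 * \sum_(a : 'X_{1..d < k.+1} | mdeg a == (k - j)%N)
                  normc (P^`M[a]).@[c 0] ^+ 2 / (mfact a)%:R.
Proof.
move=> homP jk; set g := iter j dir_deriv P.
have homg : g \is (k - j).-homog := dhomog_iter_dir_deriv j homP.
rewrite apolar_sqE (big_mksub 'X_{1..d < k.+1}) ?msupp_uniq //=; last first.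
  by move=> a /(dhomog_mf homg) /= ->; rewrite ltnS leq_subr.
rewrite big_rmcond /=; last first.
  by move=> a /memN_msupp_eq0 ->; rewrite Normc.normc0 expr0n mulr0.
rewrite mulr_sumr [RHS]big_mkcond; apply: eq_bigr => a _ /=.
case: ifPn => [/eqP akj|akj]; last first.
  by rewrite (dhomog_nemf_coeff homg akj) Normc.normc0 expr0n mulr0.
have a_neq0 : (mfact a)%:R != 0 :> R by rewrite pnatr_eq0 -lt0n mfact_gt0.
have : (mfact a)%:R * g@_a = j`!%:R * (P^`M[a]).@[c 0].
  rewrite -iter_dir_deriv_coef0 -?iter_dir_deriv_mderivm -/g; last first.
    by apply: dhomog_mderivm; rewrite akj subnK.
  rewrite mcoeff_mderivm addm0 -[RHS]mulr_natl; congr (_%:R * _).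
  by apply: eq_bigr => i _; rewrite ffactnn.
move=> /(congr1 (fun x => normc x ^+ 2)); rewrite !Normc.normcM !exprMn.
have normc_nat n : normc (n%:R : R[i]) = n%:R.
  by rewrite -(rmorph_nat (real_complex R)) /= expr0n addr0 sqrtr_sqr ger0_norm ?ler0n.
rewrite !normc_nat mulrA => <-.
by field.
Qed.

Lemma mderiv_herm_poly i : l^`M(i) = conjc (c 0 i) *: 1.
Proof.
rewrite /herm_poly raddf_sum (bigD1 i) //= big1 => [|j /negPf ji].
  by rewrite addr0 mderivZ mderivX mnm1E eqxx scale1r -{1}[U_(i)%MM]add0m addmK mpolyX0.
by rewrite mderivZ mderivX mnm1E ji scale0r scaler0.
Qed.

(** * Powers of [<z, c>] for a unit vector [c] *)

Section UnitVector.
Hypothesis c1 : hnorm c = 1.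

Lemma dir_deriv_herm_poly : dir_deriv l = 1.
Proof.
(* [c1] only controls the real part of [herm c c]; the sum is real because its terms are
   nonnegative. *)
have hcc : herm c c = 1.
  have herm_ge0 : 0 <= herm c c by apply: sumr_ge0 => i _; exact: mulcJ_ge0.
  have hermE := RRe_real (ger0_real herm_ge0).
  rewrite -hermE -[complex.Re _]sqr_sqrtr -?/(hnorm c) ?c1 ?expr1n //.
  by rewrite -ler0c hermE.
rewrite /dir_deriv; under eq_bigr do rewrite mderiv_herm_poly scalerA.
by rewrite -scaler_suml -/(herm c c) hcc scale1r.
Qed.

Lemma dir_deriv_herm_polyX n : dir_deriv (l ^+ n.+1) = n.+1%:R *: l ^+ n.
Proof.
elim: n => [|n IH]; first by rewrite expr1 dir_deriv_herm_poly scale1r.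
rewrite exprS dir_derivM dir_deriv_herm_poly IH mul1r -scalerAr -exprS.
by rewrite -[X in X + _]scale1r -scalerDl [in RHS]mulrS.
Qed.

Lemma iter_dir_deriv_herm_polyX n j : (j <= n)%N ->
  iter j dir_deriv (l ^+ n) = (n ^_ j)%:R *: l ^+ (n - j).
Proof.
elim: j => [|j IH] jn; first by rewrite subn0 ffactn0 scale1r.
rewrite iterS IH ?(ltnW jn) // linearZ /= -(subnSK jn) dir_deriv_herm_polyX.
by rewrite scalerA ffactnSr natrM subnSK.
Qed.

(** Moving [l ^+ m] across the product gives [<P, D^m (l^m P)>]. In the [j]-th Leibniz term,
    [D^(m-j)] leaves a multiple of [l^j], which moves back as [D^j] on the other argument. *)
Lemma apolar_sq_herm_polyX_mul m P :
  apolar_sq (l ^+ m * P) =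
  \sum_(j < m.+1) ('C(m, j) * m ^_ (m - j))%:R * apolar_sq (iter j dir_deriv P).
Proof.
rewrite {1}/apolar_sq apolar_mul_herm_polyX iter_dir_derivM apolar_sumr raddf_sum /=.
apply: eq_bigr => j _; have jm : (j <= m)%N by rewrite -ltnS.
rewrite iter_dir_deriv_herm_polyX ?leq_subr // subKn // -scalerAl -scaler_nat.
rewrite scalerA -natrM apolarZr conjc_nat apolarC apolar_mul_herm_polyX -apolarC.
by rewrite -(rmorph_nat (real_complex R)) Re_mulCl.
Qed.

Lemma apolar_sq_herm_polyX m : apolar_sq (l ^+ m) = m`!%:R.
Proof.
rewrite -[l ^+ m]mulr1 apolar_sq_herm_polyX_mul big_ord_recl big1 ?addr0; last first.
  move=> j _; rewrite (iter_dir_deriv_eq0 (n := 0)) ?/apolar_sq ?apolar0l ?mulr0 //.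
  exact: dhomog1.
rewrite bin0 subn0 ffactnn mul1n /= /apolar_sq -mpolyX0 apolarX mcoeffX eqxx.
by rewrite /mfact big1 ?mul1r ?conjc1 ?mulr1 // => i _; rewrite mnm0E.
Qed.

End UnitVector.

End UpperBound.

(** * Consequences of a common zero of the derivatives *)

Section Vanishing.
Variables (R : realType) (d : nat).
Implicit Types (P Q : {mpoly R[i][d]}) (c : 'rV[R[i]]_d).
Local Notation normc := Normc.normc.

(** Descending induction on the order: Euler's identity writes [k - |a|] times the value of [d^a P]
    at [c] as a combination of derivatives of order [|a| + 1], and [k - |a|] is nonzero. *)
Lemma meval_mderivm_eq0 k rho P c : P \is k.-homog -> (rho < k)%N ->
  (forall a : 'X_{1..d}, mdeg a = rho -> (P^`M[a]).@[c 0] = 0) ->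
  forall a : 'X_{1..d}, (mdeg a <= rho)%N -> (P^`M[a]).@[c 0] = 0.
Proof.
move=> homP rho_lt_k Prho a a_le.
move: {2}(rho - mdeg a)%N (erefl (rho - mdeg a)%N) => n.
elim: n a a_le => [|n IH] a a_le na.
  by apply: Prho; apply/eqP; rewrite eqn_leq a_le -subn_eq0 na.
have a_lt : (mdeg a < rho)%N by rewrite -subn_gt0 na.
have hom : P^`M[a] \is (k - mdeg a).-homog.
  by apply: dhomog_mderivm; rewrite subnKC // ltnW // (leq_ltn_trans a_le).
have := meval_dir_deriv c hom.
rewrite /dir_deriv raddf_sum big1 => [|i _] /=; last first.
  rewrite mevalZ -mderivmU1m -mderivmDm IH ?mulr0 ?mdegD ?mdeg1 //.
    by rewrite addn1.
  by rewrite addn1 subnS na.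
move/esym/eqP; rewrite mulf_eq0 pnatr_eq0 subn_eq0 leqNgt.
by rewrite (leq_ltn_trans a_le) //= => /eqP.
Qed.

Lemma mconj_mderivm_meval P a c :
  normc ((mconj P)^`M[a]).@[conjv c 0] = normc (P^`M[a]).@[c 0].
Proof.
have -> : (mconj P)^`M[a] = mconj P^`M[a].
  apply/mpolyP => b; rewrite /mconj mcoeff_mderivm !mcoeff_map_mpoly mcoeff_mderivm.
  by rewrite raddfMn.
have -> Q : (mconj Q).@[conjv c 0] = conjc Q.@[c 0].
  elim/mpolyind: Q => [|x b Q _ _ IH].
    by rewrite /mconj rmorph0 !meval0 rmorph0.
  have -> : mconj (x *: 'X_[b] + Q) = conjc x *: 'X_[b] + mconj Q.
    by rewrite /mconj raddfD /= map_mpolyZ map_mpolyX.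
  rewrite !mevalD !mevalZ !mevalX IH (rmorphD conjc) (rmorphM conjc) /= (rmorph_prod conjc).
  by congr (_ * _ + _); apply: eq_bigr => i _; rewrite mxE (rmorphXn conjc).
by case: (_.@[_]) => x y /=; rewrite sqrrN.
Qed.

(** Termwise comparison in [j], where [|a| = k - j]: beyond [k] the iterated derivative is 0, from
    [k - rho] to [k] the values at [c] vanish, and below [k - rho] the coefficients are compared. *)
Lemma apolar_sq_mul_herm_polyX_le k rho m P c :
  (rho < k)%N -> (k <= m)%N -> P \is k.-homog -> hnorm c = 1 ->
  (forall a : 'X_{1..d}, mdeg a = rho -> (P^`M[a]).@[c 0] = 0) ->
  apolar_sq (P * herm_poly c ^+ m) <=
    C2 k rho P c ^+ 2 * m%:R ^+ (k - rho - 1) * apolar_sq (herm_poly c ^+ m).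
Proof.
move=> rho_lt_k k_le_m homP c1 /(meval_mderivm_eq0 homP rho_lt_k) Pc.
have m_gt0 : (0 < m)%N by apply: leq_trans k_le_m; apply: leq_ltn_trans rho_lt_k.
pose F (a : 'X_{1..d < k.+1}) := normc (P^`M[a]).@[c 0] ^+ 2 / (mfact a)%:R.
have F_ge0 a : 0 <= F a by rewrite mulr_ge0 ?sqr_ge0 ?invr_ge0 ?ler0n.
rewrite mulrC (apolar_sq_herm_polyX_mul c1) (apolar_sq_herm_polyX c1).
(* The sum is grouped by [j = k - |a|]; all these [j] are in range because [k <= m]. *)
have -> : C2 k rho P c ^+ 2 =
    \sum_(j < m.+1) \sum_(a | (rho < mdeg (bmnm a) <= k)%N && (j == k - mdeg (bmnm a) :> nat)%N) F a.
  rewrite sqr_sqrtr; last first.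
    by apply: sumr_ge0 => a _; rewrite mulr_ge0 ?sqr_ge0 ?invr_ge0 ?ler0n.
  under eq_bigr do rewrite mconj_mderivm_meval.
  rewrite (exchange_big_dep (fun a : 'X_{1..d < k.+1} => (rho < mdeg a <= k)%N)) /=; last first.
    by move=> j a _ /andP[].
  apply: eq_bigr => a ak; have jP : (k - mdeg a < m.+1)%N.
    by rewrite ltnS (leq_trans (leq_subr _ _)).
  rewrite (big_pred1 (Ordinal jP)) // => j.
  by rewrite ak. 
rewrite -mulrA [leRHS]mulrC mulr_sumr; apply: ler_sum => j _.
have jm : (j <= m)%N by rewrite -ltnS.
have rhs_ge0 : 0 <= m%:R ^+ (k - rho - 1) * m`!%:R *
    \sum_(a | (rho < mdeg (bmnm a) <= k)%N && (j == k - mdeg (bmnm a) :> nat)%N) F a.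
  by rewrite mulr_ge0 ?mulr_ge0 ?exprn_ge0 ?ler0n // sumr_ge0.
have [kj|jk] := ltnP k j.
  by rewrite (iter_dir_deriv_eq0 c homP kj) {1}/apolar_sq apolar0l mulr0.
rewrite (apolar_sq_iter_dir_deriv c homP jk).
have [j_lt|j_ge] := ltnP j (k - rho).
  have -> : \sum_(a : 'X_{1..d < k.+1} | mdeg a == (k - j)%N) F a =
      \sum_(a | (rho < mdeg (bmnm a) <= k)%N && (j == k - mdeg (bmnm a) :> nat)%N) F a.
    apply: eq_bigl => a; have := bmdeg a; rewrite ltnS => ak.
    rewrite ak andbT; apply/eqP/andP => [->|[_ /eqP ->]].
      by rewrite subKn // eqxx ltn_subCr.
    by rewrite subKn.
  rewrite mulrA; apply: ler_wpM2r; first exact: sumr_ge0.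
  (* Here ['C(m, j) * j! = m ^_ j] and [m ^_ (m - j) * j! = m!], one factor [j!] for each. *)
  have -> : ('C(m, j) * m ^_ (m - j))%:R * j`!%:R ^+ 2 = (m ^_ j)%:R * m`!%:R :> R.
    have <- : (m ^_ (m - j) * j`! = m`!)%N by rewrite -[in j`!](subKn jm) ffact_fact ?leq_subr.
    by rewrite -natrX -!natrM -(bin_ffact m j) expnS expn1 mulnACA.
  rewrite ler_wpM2r ?ler0n // -natrX ler_nat.
  (* The falling factorial has [j] factors, each at most [m], and [j <= k - rho - 1]. *)
  apply: (@leq_trans (m ^ j)%N).
    rewrite ffact_prod -[X in (_ <= _ ^ X)%N]card_ord -prod_nat_const.
    by apply: leq_prod => i _; exact: leq_subr.
  by rewrite leq_pexp2l // subn1 -ltnS prednK // subn_gt0.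
rewrite [X in _ * (_ * X)]big1 ?mulr0 // => a /eqP aj.
rewrite Pc ?Normc.normc0 ?expr0n ?mul0r //.
by rewrite aj leq_subCl.
Qed.

End Vanishing.

(** * From squared norms back to norms *)

Lemma sqr_powR_half (R : realType) (x : R) n : 0 <= x ->
  (x `^ (n%:R / 2)) ^+ 2 = x ^+ n.
Proof.
move=> x_ge0; rewrite -powR_mulrn ?powR_ge0 // -powRrM divfK ?pnatr_eq0 //.
by rewrite powR_mulrn.
Qed.

Theorem theorem1 (R : realType) (d k rho : nat) (P : {mpoly R[i][d]})
    (hd : (1 <= d)%N) (hk : (2 <= k)%N) (hrho : (1 <= rho < k)%N)
    (hP0 : P != 0) (hP : P \is k.-homog) :
  (~ (exists2 c : 'rV[R[i]]_d, c != 0 &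
        forall a : 'X_{1..d}, mdeg a = rho -> (P^`M[a]).@[c 0] = 0) ->
   forall (m : nat) (f : {mpoly R[i][d]}), f \is m.-homog ->
     apolar_norm (P * f) >=
       C1 k rho P * (m + d)%N%:R `^ ((k - rho)%N%:R / 2) * apolar_norm f)
  /\
  (forall c : 'rV[R[i]]_d, hnorm c = 1 ->
     (forall a : 'X_{1..d}, mdeg a = rho -> (P^`M[a]).@[c 0] = 0) ->
   forall m : nat, (k <= m)%N ->
     apolar_norm (P * herm_poly c ^+ m) <=
       C2 k rho P c * m%:R `^ ((k - rho - 1)%N%:R / 2)
         * apolar_norm (herm_poly c ^+ m)).
Proof.
have /andP[_ rho_lt_k] := hrho.
have norm_sq f : apolar_norm f ^+ 2 = apolar_sq f by rewrite sqr_sqrtr ?apolar_sq_ge0.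
have norm_ge0 f : 0 <= apolar_norm f by exact: sqrtr_ge0.
have le_of_sqr (x y : R) : 0 <= y -> x ^+ 2 <= y ^+ 2 -> x <= y.
  by move=> y_ge0 xy; rewrite leNgt; apply/negP; nra.
have sqrM3 (x y z : R) : (x * y * z) ^+ 2 = x ^+ 2 * y ^+ 2 * z ^+ 2 by rewrite !exprMn.
split=> [_ m f homf|c c1 Pc m k_le_m].
  apply: le_of_sqr => //; rewrite sqrM3 !norm_sq sqr_powR_half ?ler0n //.
  have k_gt0 : 0 < k%:R :> R by rewrite ltr0n (leq_trans _ hk).
  have B_gt0 : 0 < 'C(d + rho - 1, rho)%:R :> R.
    by rewrite ltr0n bin_gt0 -addnBAC // leq_addl.
  rewrite /C1 sqrM3.
  have -> : ('C(d + rho - 1, rho)%:R `^ (- 2^-1)) ^+ 2 = 'C(d + rho - 1, rho)%:R^-1 :> R.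
    by rewrite powRN powR12_sqrt ?ler0n // exprVn sqr_sqrtr ?ler0n.
  have := apolar_sq_mul_ge rho_lt_k hd hP homf.
  set B := 'C(_, _)%:R; set G := apolar_sq (P * f).
  rewrite mulrA -ler_pdivrMl ?mulr_gt0 ?B_gt0 ?exprn_gt0 ?k_gt0 //.
  (* With the constants divided out, the left side is the squared bound itself, so only an identity
     remains. *)
  rewrite mulnC exprM; apply: le_trans; rewrite le_eqVlt; apply/orP; left; apply/eqP.
  by field; rewrite expf_neq0 ?lt0r_neq0.
apply: le_of_sqr; first by rewrite !mulr_ge0 ?powR_ge0 ?sqrtr_ge0.
rewrite sqrM3 !norm_sq sqr_powR_half ?ler0n //.
exact: apolar_sq_mul_herm_polyX_le.
Qed.
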